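(* Let $j$ be a nonnegative integer and $n$ an integer with $n\ge j$. Then \[\sum_{m\ge j}M(m,n)\] (the number of partitions of $n$ with crank at least $j$) equals the number of partitions of $n-j$ whose Frobenius symbol has no entry equal to $j$ in its top row.
   Context: The Frobenius symbol of a partition $\lambda$ with Durfee square of size $s$ is the two-row array whose top row is $(\lambda_1-1,\lambda_2-2,\dots,\lambda_s-s)$ and whose bottom row is $(\lambda'_1-1,\dots,\lambda'_s-s)$, where $\lambda'$ is the conjugate partition. The empty partition has the empty symbol. Write $(q)_\infty=\prod_{i\ge1}(1-q^i)$. $M(m,n)$, the number of partitions of $n$ with crank $m$, is defined by Garvan's generating function \[\sum_{n\ge0}M(m,n)q^n=\frac{1}{(q)_\infty}\sum_{r\ge1}(-1)^{r-1}q^{r(r-1)/2+r|m|}(1-q^r).\] This agrees with the combinatorial crank count except at $n=1$. *)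

(* Defs.v *)
From HB Require Import structures.
From mathcomp Require Import all_boot all_order all_algebra.

Set Implicit Arguments.
Unset Strict Implicit.
Unset Printing Implicit Defensive.

Import GRing.Theory.
Local Open Scope ring_scope.

(* An integer series converges in the discrete topology iff its partial sums
   are eventually constant, i.e., iff it has finitely many nonzero terms. *)
Definition sums_from (j : nat) (f : nat -> int) (s : int) : Prop :=
  exists N0 : nat, forall N : nat, (N0 <= N)%N -> \sum_(j <= m < N) f m = s.

(* Formal power series over int, as coefficient sequences. *)
Definition fps := nat -> int.

Definition fps_mul (f g : fps) : fps :=
  fun n => \sum_(i < n.+1) f i * g (n - i)%N.

Fixpoint fps_inv_seq (f : fps) (n : nat) : seq int :=
  if n is k.+1 then
    let g := fps_inv_seq f k in
    rcons g ((f 0%N)^-1 * ((k == 0%N)%:R - \sum_(i < k) f (k - i)%N * g`_i))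
  else [::].

(* The multiplicative inverse of f, meaningful when f 0%N is a unit. *)
Definition fps_inv (f : fps) : fps := fun n => (fps_inv_seq f n.+1)`_n.

Lemma size_fps_inv_seq f n : size (fps_inv_seq f n) = n.
Proof. by elim: n => //= n IHn; rewrite size_rcons IHn. Qed.

Lemma nth_fps_inv_seq f n i : (i < n)%N -> (fps_inv_seq f n)`_i = fps_inv f i.
Proof.
elim: n => // n IHn; rewrite ltnS leq_eqVlt => /predU1P[-> // | lt_in].
by rewrite /= nth_rcons size_fps_inv_seq lt_in IHn.
Qed.

Lemma fps_mulV f : f 0%N \is a GRing.unit ->
  fps_mul f (fps_inv f) =1 fun n => (n == 0%N)%:R.
Proof.
move=> f0U n; rewrite /fps_mul big_ord_recl subn0 {1}/fps_inv /=.
rewrite nth_rcons size_fps_inv_seq ltnn eqxx mulVKr //.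
rewrite -[RHS](subrK (\sum_(i < n) f (n - i)%N * (fps_inv_seq f n)`_i)).
congr (_ + _); rewrite (reindex_inj rev_ord_inj); apply: eq_bigr => i _ /=.
by rewrite /bump leq0n add1n subnSK // subKn ?nth_fps_inv_seq // ltnW.
Qed.

(* The factors with i > n do not affect the coefficient of q^n. *)
Definition qpoch_inf : fps :=
  fun n => (\prod_(1 <= i < n.+1) (1 - 'X^i) : {poly int})`_n.

Lemma qpoch_infP n N : (n < N)%N ->
  (\prod_(1 <= i < N) (1 - 'X^i) : {poly int})`_n = qpoch_inf n.
Proof.
elim: N => // N IHN; rewrite ltnS leq_eqVlt => /predU1P[-> // | lt_nN].
rewrite big_nat_recr ?(leq_ltn_trans _ lt_nN) //= mulrBr mulr1 coefB coefMXn.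
by rewrite lt_nN subr0 IHN.
Qed.

Lemma qpoch_inf0 : qpoch_inf 0%N = 1.
Proof. by rewrite /qpoch_inf big_geq // coef1. Qed.

Definition garvan_term (m : int) (r : nat) : {poly int} :=
  (-1) ^+ (r - 1) *: ('X^((r * (r - 1))./2 + r * `|m|)%N * (1 - 'X^r)).

(* The terms with r > n + 1 do not affect the coefficient of q^n. *)
Definition garvan_sum (m : int) : fps :=
  fun n => (\sum_(1 <= r < n.+2) garvan_term m r)`_n.

Lemma garvan_sumP m n :
  sums_from 1 (fun r => (garvan_term m r)`_n) (garvan_sum m n).
Proof.
exists n.+2 => N le_nN; rewrite /garvan_sum coef_sum.
rewrite (@big_cat_nat _ _ _ n.+2) //= -[RHS]addr0; congr (_ + _).
rewrite big_nat big1 // => r /andP[lt_nr _].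
rewrite /garvan_term coefZ coefXnM ifT ?mulr0 //.
case: r lt_nr => [|[|r]] //; rewrite !ltnS => le_nr.
apply: ltn_addr; rewrite subSS subn0 (leq_ltn_trans le_nr) //.
by rewrite geq_half_double -mul2n leq_mul.
Qed.

Definition crank_M (m : int) : nat -> int :=
  fps_mul (fps_inv qpoch_inf) (garvan_sum m).

Definition is_intpart (n : nat) (l : seq nat) : bool :=
  [&& sorted geq l, 0%N \notin l & sumn l == n].

Record intpart (n : nat) :=
  IntPart { parts :> seq nat; _ : is_intpart n parts }.

HB.instance Definition _ n := [isSub for @parts n].
HB.instance Definition _ n := [Countable of intpart n by <:].

Definition intpart_code n (l : intpart n) : {bseq n of 'I_n.+1} :=
  insub_bseq n (map inord l).

Definition intpart_decode n (b : {bseq n of 'I_n.+1}) : option (intpart n) :=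
  insub (map val b).

Lemma intpart_codeK n : pcancel (@intpart_code n) (@intpart_decode n).
Proof.
case=> l Pl; rewrite /intpart_decode /intpart_code /=.
have /and3P[_ nz_l /eqP sum_l] := Pl.
have le_l : (size l <= n)%N.
  rewrite -sum_l; elim: l nz_l {Pl sum_l} => //= x l IHl.
  rewrite inE negb_or eq_sym -lt0n => /andP[x_gt0 /IHl].
  by rewrite -add1n; apply: leq_add.
have lt_l x : x \in l -> (x < n.+1)%N.
  rewrite ltnS -sum_l; elim: l {Pl nz_l sum_l le_l} => //= y l IHl.
  rewrite inE => /predU1P[-> | /IHl le_x]; first exact: leq_addr.
  exact: leq_trans le_x (leq_addl _ _).
have -> : map val (insub_bseq n (map (@inord n) l)) = l.
  rewrite /insub_bseq insubdK ?unfold_in ?size_map // -map_comp.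
  by apply: map_id_in => x /lt_l /=; apply: inordK.
by rewrite (insubT (is_intpart n) Pl).
Qed.

HB.instance Definition _ n : isFinite (intpart n) :=
  PCanIsFinite (@intpart_codeK n).

Definition conj_parts (l : seq nat) : seq nat :=
  mkseq (fun i => count (fun x => i < x)%N l) (head 0%N l).

(* The side of the largest square contained in the Young diagram of l. *)
Definition durfee (l : seq nat) : nat :=
  \max_(s < (size l).+1 | [forall i : 'I_s, (s <= nth 0 l i)%N]) s.

(* Indices are shifted by one; the subtractions are exact, as both l and its
   conjugate have their first durfee l parts at least durfee l. *)
Definition frobenius_symbol (l : seq nat) : seq nat * seq nat :=
  (mkseq (fun i => nth 0 l i - i.+1)%N (durfee l),
   mkseq (fun i => nth 0 (conj_parts l) i - i.+1)%N (durfee l)).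

(* Main.v *)
Require Import Defs.
From mathcomp Require Import all_boot all_order all_algebra.
From mathcomp Require Import zify.

(**
  Summing Garvan's series over m >= j telescopes to T_j / (q)_oo, where
  T_j = \sum_(r >= 1) (-1)^(r-1) q^(r(r-1)/2 + rj) satisfies
  T_j = q^j - q^j T_(j+1).  Let F_j(N) count the partitions of N without j in
  the top row of their Frobenius symbol.  Since 1 / (q)_oo counts partitions,
  it suffices to show the matching recursion p(N) - F_j(N) = F_(j+1)(N - j - 1).
  A partition l has j in the top row iff l_i = i + j for some i; deleting this
  part and adding 1 to each of the i - 1 parts above it is a bijection onto the
  partitions of N - j - 1 without j + 1 in the top row.
*)

Set Implicit Arguments.
Unset Strict Implicit.
Unset Printing Implicit Defensive.

Import GRing.Theory.
Local Open Scope ring_scope.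

(** * Counting partitions *)

Definition npart (n : nat) (P : pred (seq nat)) : nat :=
  #|[set l : intpart n | P l]|.

Lemma npart_ext n (P Q : pred (seq nat)) :
  (forall l, is_intpart n l -> P l = Q l) -> npart n P = npart n Q.
Proof.
by move=> eqPQ; apply: eq_card => l; rewrite !inE (eqPQ _ (valP l)).
Qed.

Lemma npart_eq0 n (P : pred (seq nat)) :
  (forall l, is_intpart n l -> ~~ P l) -> npart n P = 0%N.
Proof.
by move=> P0; apply: eq_card0 => l; rewrite !inE (negPf (P0 _ (valP l))).
Qed.

Lemma npart_split (Q P : pred (seq nat)) n :
  npart n P = (npart n [pred l | P l & Q l] + npart n [pred l | P l & ~~ Q l])%N.
Proof.
rewrite /npart -(cardsID [set l : intpart n | Q l]); congr (_ + _)%N.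
  by apply: eq_card => l; rewrite !inE.
by apply: eq_card => l; rewrite !inE andbC.
Qed.

Lemma npart_leq (f g : seq nat -> seq nat) m n (P Q : pred (seq nat)) :
    (forall l, is_intpart m l -> P l -> is_intpart n (f l) && Q (f l)) ->
    (forall l, is_intpart m l -> P l -> g (f l) = l) ->
  (npart m P <= npart n Q)%N.
Proof.
move=> fPQ fK; rewrite /npart !cardE.
set s := enum _; set t := enum _.
have sP l : l \in s -> P l by rewrite mem_enum inE.
rewrite -(size_map (f \o val) s) -(size_map val t).
apply: uniq_leq_size.
  rewrite map_inj_in_uniq ?enum_uniq // => l1 l2 /sP P1 /sP P2 /= eq_f.
  by apply: val_inj; rewrite -(fK _ (valP l1) P1) eq_f (fK _ (valP l2) P2).
move=> _ /mapP[l /sP Pl ->] /=.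
have /andP[fn Qf] := fPQ _ (valP l) Pl.
by apply/mapP; exists (IntPart fn); rewrite // mem_enum inE.
Qed.

Lemma npart_bij (f g : seq nat -> seq nat) m n (P Q : pred (seq nat)) :
    (forall l, is_intpart m l -> P l -> is_intpart n (f l) && Q (f l)) ->
    (forall l, is_intpart n l -> Q l -> is_intpart m (g l) && P (g l)) ->
    (forall l, is_intpart m l -> P l -> g (f l) = l) ->
    (forall l, is_intpart n l -> Q l -> f (g l) = l) ->
  npart m P = npart n Q.
Proof.
move=> fPQ gQP fK gK; apply/eqP; rewrite eqn_leq.
by rewrite (npart_leq fPQ fK) (npart_leq gQP gK).
Qed.

(** No part exceeds the sum, so the bound costs nothing, and [path], unlike [sorted], passes to the
    tail under induction. *)
Lemma is_intpart_path n l :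
  is_intpart n l = [&& path geq (sumn l) l, 0%N \notin l & sumn l == n].
Proof.
by rewrite /is_intpart; case: l => //= x l; rewrite /geq /= leq_addr.
Qed.

Lemma path_is_intpart b n l :
  path geq b l -> 0%N \notin l -> sumn l = n -> is_intpart n l.
Proof. by move=> /path_sorted l_sorted l0 <-; rewrite /is_intpart l_sorted l0 /=. Qed.

(** * Euler's product *)

Lemma npart_path0 n : npart n (path geq 0%N) = (n == 0%N).
Proof.
case: n => [|n]; last first.
  apply: npart_eq0 => -[|x l] //= /and3P[_ /=].
  by rewrite inE negb_or eq_sym /geq /= -lt0n => /andP[x0 _] _; lia.
rewrite (@npart_ext _ _ predT) => [|[|x l] //]; last first.
  case/and3P=> _ /=; rewrite inE negb_or eq_sym -lt0n => /andP[x0 _] /eqP.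
  lia.
rewrite /npart -[RHS](cards1 (@IntPart 0 [::] isT)).
apply: eq_card => l; rewrite !inE; symmetry; apply/eqP/val_inj => /=.
case: l => -[|x l] //= /and3P[_ /=]; rewrite inE negb_or eq_sym -lt0n.
by case/andP=> x0 _ /eqP; lia.
Qed.

Lemma npart_path_small k n : (n <= k)%N -> npart n (path geq k) = npart n predT.
Proof.
move=> le_nk; apply: npart_ext => l; rewrite is_intpart_path.
case/and3P=> + _ /eqP sl; rewrite sl.
by case: l {sl} => //= x l /andP[xn ->]; rewrite andbT; apply: leq_trans le_nk.
Qed.

(** On a partition, [path geq k] bounds all parts by [k]. Either the largest part is [k.+1], and one
    copy of it can be removed, or all parts are at most [k]. *)
Lemma npart_pathS k n : (k < n)%N ->
  npart n (path geq k.+1) = (npart n (path geq k) + npart (n - k.+1) (path geq k.+1))%N.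
Proof.
move=> lt_kn; rewrite (npart_split (fun l => head 0%N l == k.+1)) addnC.
congr (_ + _)%N.
  apply: npart_ext => -[|x l] //= _.
  by rewrite andbAC; congr (_ && _); rewrite /geq /=; lia.
apply: (npart_bij (f := behead) (g := cons k.+1)) => [[|x l]|l|[|x l]|] //=.
- move=> /and3P[_ /=]; rewrite inE negb_or => /andP[_ l0] /eqP sl.
  case/andP=> /andP[_ pl] /eqP xk; rewrite -xk pl andbT.
  by apply: path_is_intpart pl l0 _; rewrite -sl addKn.
- case/and3P=> _ l0 /eqP sl pl; rewrite pl eqxx /geq /= leqnn !andbT.
  rewrite /is_intpart /= pl inE negb_or l0 sl /=; apply/eqP; lia.
- by move=> _ /andP[_ /eqP ->].
Qed.

(** By [npart_pathS], the factor [1 - 'X^k.+1] turns the series for parts at most [k.+1] into the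
    one for parts at most [k]. *)
Lemma euler_coef k N n : (n < N)%N ->
  ((\prod_(1 <= i < k.+1) (1 - 'X^i) : {poly int}) *
     \poly_(i < N) (npart i (path geq k))%:Z)`_n = (n == 0%N)%:R.
Proof.
elim: k n => [|k IHk] n lt_nN.
  by rewrite big_geq // mul1r coef_poly lt_nN npart_path0; case: eqP.
rewrite big_nat_recr //= -mulrA -(IHk n lt_nN) !coefM.
apply: eq_bigr => i _; congr (_ * _).
rewrite mulrBl mul1r coefB coefXnM !coef_poly.
have lt_mN: (n - i < N)%N by lia.
move: (n - i)%N lt_mN => m lt_mN; rewrite lt_mN.
have [lt_mk | le_km] := ltnP m k.+1.
  by rewrite subr0 !npart_path_small // ltnW.
by rewrite ifT 1?npart_pathS //; lia.
Qed.

Lemma fps_mul_inj f g h : f 0%N \is a GRing.unit ->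
  fps_mul f g =1 fps_mul f h -> g =1 h.
Proof.
move=> f0U eq_fgh n; elim/ltn_ind: n => n IHn.
have eq_sum : \sum_(i < n) f (bump 0 i) * g (n - bump 0 i)%N =
    \sum_(i < n) f (bump 0 i) * h (n - bump 0 i)%N.
  by apply: eq_bigr => i _; rewrite IHn // /bump; have := ltn_ord i; lia.
apply: (mulrI f0U); have := eq_fgh n; rewrite /fps_mul !big_ord_recl /= !subn0.
by rewrite eq_sum; apply: addIr.
Qed.

Lemma fps_inv_qpoch n : fps_inv qpoch_inf n = (npart n predT)%:Z.
Proof.
have qU : qpoch_inf 0%N \is a GRing.unit by rewrite qpoch_inf0 unitr1.
apply: (fps_mul_inj (f := qpoch_inf) (h := fun n => (npart n predT)%:Z)) => // {}n.
rewrite fps_mulV // -(euler_coef n (ltnSn n)) coefM; apply: eq_bigr => i _.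
rewrite qpoch_infP // coef_poly ltnS leq_subr.
by rewrite npart_path_small // leq_subr.
Qed.

(** * The top row of the Frobenius symbol *)

(* For l = (l_1, l_2, ...), [has_arm j l] says that l_i = i + j for some i;
   peeling off the first part replaces j by j + 1. *)
Fixpoint has_arm (j : nat) (l : seq nat) : bool :=
  if l is x :: l' then (x == j.+1) || has_arm j.+1 l' else false.

Lemma has_armP j l : reflect (exists i, nth 0%N l i = (i.+1 + j)%N) (has_arm j l).
Proof.
elim: l j => [|x l IHl] j /=.
  by constructor=> -[i]; rewrite nth_nil.
apply: (iffP orP) => [[/eqP -> | /IHl[i eq_i]] | [[|i] /= eq_i]].
- by exists 0%N.
- by exists i.+1; rewrite /= eq_i addnS.
- by left; apply/eqP.
- by right; apply/IHl; exists i; rewrite eq_i addnS.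
Qed.

(** The maximum defining [durfee l] itself satisfies the square condition. Conversely, the rows
    above row [i] are at least as long, so they complete a square of side [i.+1]. *)
Lemma lt_durfee l i : sorted geq l -> (i < durfee l)%N = (i < nth 0%N l i)%N.
Proof.
move=> l_sorted; apply/idP/idP => [lt_id | lt_il].
  have: [forall k : 'I_(durfee l), (durfee l <= nth 0%N l k)%N].
    rewrite /durfee; apply: (big_ind (fun d : nat =>
      [forall k : 'I_d, (d <= nth 0%N l k)%N])) => [|d e Pd Pe|] //.
      by apply/forallP => -[].
    by rewrite /maxn; case: ifP.
  by move/forallP/(_ (Ordinal lt_id)) => /=; apply: leq_trans.
have lt_is: (i.+1 < (size l).+1)%N.
  rewrite ltnS ltnNge; apply/negP => le_si.
  by rewrite nth_default in lt_il.
rewrite /durfee (bigD1 (Ordinal lt_is)) /= ?leq_max ?leqnn //.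
apply/forallP => -[k /=]; rewrite ltnS => le_ki; apply: leq_trans lt_il _.
have geq_trans : transitive geq by move=> y x z /= le_yx le_zy; apply: leq_trans le_zy le_yx.
have geq_refl : reflexive geq by move=> x /=.
by apply: (sorted_leq_nth geq_trans geq_refl _ _ _ _ _ _ le_ki); rewrite ?inE; lia.
Qed.

(** An equation l_i = i + j already places row i inside the Durfee square, where the truncated
    subtraction is exact. *)
Lemma mem_frobenius_top j l :
  sorted geq l -> (j \in (frobenius_symbol l).1) = has_arm j l.
Proof.
move=> l_sorted; apply/mapP/has_armP => [[i] | [i eq_i]].
  rewrite mem_iota /= add0n lt_durfee // => lt_i ->.
  by exists i; rewrite subnKC.
exists i; last by rewrite eq_i addKn.
by rewrite mem_iota /= add0n lt_durfee // eq_i leq_addr.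
Qed.

(** * The bijection *)

(* Both functions trace i in [has_arm]: [arm_drop] deletes the part i + j and
   increments the parts above it, [arm_insert] undoes this. *)
Fixpoint arm_drop (j : nat) (l : seq nat) : seq nat :=
  if l is x :: l' then
    if x == j.+1 then l' else x.+1 :: arm_drop j.+1 l'
  else [::].

Fixpoint arm_insert (j : nat) (l : seq nat) : seq nat :=
  if l is x :: l' then
    if (x <= j.+1)%N then j.+1 :: l else x.-1 :: arm_insert j.+1 l'
  else [:: j.+1].

Lemma path_has_arm b j l : path geq b l -> has_arm j l -> (j < b)%N.
Proof.
elim: l b j => //= x l IHl b j /andP[xb pl] /orP[/eqP xj | /(IHl _ _ pl)];
  move: xb; rewrite /geq /=; lia.
Qed.

Lemma path_arm_drop b j l : path geq b l -> path geq b.+1 (arm_drop j l).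
Proof.
elim: l b j => //= x l IHl b j /andP[xb pl]; case: eqP => [_ | _] /=.
  case: l pl {IHl} => //= y l /andP[yx ->]; move: xb yx; rewrite /geq /=; lia.
by rewrite IHl // andbT; move: xb; rewrite /geq /=; lia.
Qed.

Lemma arm_drop_notin0 j l : 0%N \notin l -> 0%N \notin arm_drop j l.
Proof.
elim: l j => //= x l IHl j; rewrite inE negb_or => /andP[_ l0].
by case: ifP => // _; rewrite inE /= IHl.
Qed.

Lemma sumn_arm_drop j l : has_arm j l -> (sumn (arm_drop j l) + j.+1)%N = sumn l.
Proof.
elim: l j => //= x l IHl j; case: eqP => [-> _ | _ /= /IHl]; lia.
Qed.

(** An incremented part could only match if it had matched before the increment, where the recursion
    stops; the parts below the deleted one are too small by [path_has_arm]. *)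
Lemma has_arm_drop b j l : path geq b l -> ~~ has_arm j.+1 (arm_drop j l).
Proof.
elim: l b j => //= x l IHl b j /andP[xb pl]; case: eqP => [xj | /eqP xj] /=.
  by apply/negP => /(path_has_arm pl); lia.
by rewrite negb_or (IHl _ _ pl) andbT eqSS.
Qed.

Lemma arm_dropK b j l : path geq b l -> has_arm j l ->
  arm_insert j (arm_drop j l) = l.
Proof.
elim: l b j => //= x l IHl b j /andP[xb pl]; case: eqP => [xj _ | xj /= hl] /=.
  (* The part after the deleted one is at most [j.+1], so insertion stops exactly here. *)
  by case: l pl {IHl} => [|y l] /= => [_|/andP[yx _]]; rewrite -xj // ifT.
by rewrite (IHl _ _ pl hl) ifF //; have := path_has_arm pl hl; lia.
Qed.

(** The absence of arm [j.+1] excludes [x = j.+2], so a part that is passed over exceeds [j.+2];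
    this is the bound hypothesis for the recursive call. *)
Lemma path_arm_insert b j l :
  (j.+1 < b)%N -> path geq b l -> ~~ has_arm j.+1 l -> path geq b.-1 (arm_insert j l).
Proof.
elim: l b j => [|x l IHl] b j jb /=; first by rewrite /geq /=; lia.
case/andP=> xb pl; rewrite negb_or => /andP[xj hl].
case: ifP => [le_xj | lt_jx] /=.
  by rewrite pl andbT /geq /=; lia.
by rewrite IHl // ?andbT; move: xb xj; rewrite /geq /=; lia.
Qed.

Lemma arm_insert_notin0 j l : 0%N \notin l -> 0%N \notin arm_insert j l.
Proof.
elim: l j => //= x l IHl j; rewrite inE negb_or => /andP[x0 l0].
by case: ifP => x_j; rewrite !inE !negb_or ?x0 ?l0 ?IHl // andbT; lia.
Qed.

Lemma sumn_arm_insert j l : sumn (arm_insert j l) = (sumn l + j.+1)%N.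
Proof.
elim: l j => [|x l IHl] j /=; first by rewrite addn0.
by case: ifP => x_j /=; rewrite ?IHl; lia.
Qed.

Lemma has_arm_insert j l : has_arm j (arm_insert j l).
Proof.
by elim: l j => [|x l IHl] j /=; [|case: ifP => _ /=]; rewrite ?eqxx ?IHl ?orbT.
Qed.

Lemma arm_insertK j l : ~~ has_arm j.+1 l -> arm_drop j (arm_insert j l) = l.
Proof.
elim: l j => [|x l IHl] j /=; first by rewrite eqxx.
rewrite negb_or => /andP[xj hl]; case: ifP => x_j /=; first by rewrite eqxx.
by rewrite ifF ?IHl ?prednK //; lia.
Qed.

Lemma npart_has_arm j n : npart n (has_arm j) =
  if (j < n)%N then npart (n - j.+1) [pred l | ~~ has_arm j.+1 l] else 0%N.
Proof.
case: ltnP => [lt_jn | le_nj]; last first.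
  apply: npart_eq0 => l /and3P[_ _ /eqP sl]; apply/negP => /sumn_arm_drop; lia.
apply: (npart_bij (f := arm_drop j) (g := arm_insert j)) => l;
  rewrite is_intpart_path => /and3P[pl l0 /eqP sl] /= hl.
- rewrite (has_arm_drop _ pl) andbT.
  apply: (path_is_intpart (path_arm_drop j pl)); first exact: arm_drop_notin0.
  by have := sumn_arm_drop hl; lia.
- rewrite has_arm_insert andbT.
  (* The summand [j.+2] secures [j.+1 < b] in [path_arm_insert], even for the empty list. *)
  have {}pl: path geq (sumn l + j.+2) l.
    by case: l pl {l0 sl hl} => //= x l /andP[_ ->]; rewrite /geq /=; lia.
  apply: (path_is_intpart (path_arm_insert _ pl hl)); first lia.
    exact: arm_insert_notin0.
  by rewrite sumn_arm_insert; lia.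
- exact: arm_dropK pl hl.
- exact: arm_insertK.
Qed.

(** * Garvan's series *)

(** Allows one truncation [R] to serve all coefficients below it: later terms start at degree
    r(r-1)/2 > n. *)
Lemma garvan_sum_coef m n R : (n < R)%N ->
  garvan_sum m n = (\sum_(1 <= r < R.+1) garvan_term m r)`_n.
Proof.
move=> lt_nR; rewrite /garvan_sum !coef_sum.
rewrite [RHS](@big_cat_nat _ _ _ n.+2) //= -[LHS]addr0; congr (_ + _).
rewrite big_nat big1 // => r /andP[lt_nr _].
rewrite /garvan_term coefZ coefXnM ifT ?mulr0 //.
apply: ltn_addr; rewrite geq_half_double -mul2n.
by apply: leq_mul; lia.
Qed.

(** The first [R] terms of T_j, with the index r shifted down to start at 0. *)
Definition crank_tail (j R : nat) : {poly int} :=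
  \sum_(r < R) (-1) ^+ r *: 'X^((r.+1 * r)./2 + r.+1 * j).

Lemma crank_tailS j R :
  crank_tail j R.+1 = 'X^j - 'X^j * crank_tail j.+1 R.
Proof.
rewrite /crank_tail big_ord_recl expr0 scale1r !mul1n add0n; congr (_ + _).
rewrite mulr_sumr -sumrN; apply: eq_bigr => r _.
rewrite -scalerAr -scaleNr -exprD lift0 exprS mulN1r.
congr (_ *: 'X^_); have -> : (r.+2 * r.+1 = r.+1 * r + r.+1.*2)%N by lia.
by rewrite halfD doubleK odd_double andbF; lia.
Qed.

(** For fixed r, the factor 1 - q^r makes the sum over m telescope, since q^(rm) (1 - q^r) = q^(rm)
    - q^(r(m+1)). *)
Lemma sum_garvan_term j M R : (j <= M)%N ->
  \sum_(j <= m < M) \sum_(1 <= r < R.+1) garvan_term (Posz m) r =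
  crank_tail j R - crank_tail M R.
Proof.
move=> le_jM; rewrite exchange_big /= big_add1 big_mkord -sumrB.
apply: eq_bigr => r _; rewrite -scalerBr -scaler_sumr subn1 /=; congr (_ *: _).
pose f m : {poly int} := 'X^((r.+1 * r)./2 + r.+1 * m).
rewrite -[RHS]opprB -(telescope_sumr f le_jM) -sumrN; apply: eq_bigr => m _.
by rewrite /f opprB mulnSr addnA mulrBr mulr1 -exprD.
Qed.

Lemma mul_crank_tail_coef0 (p : {poly int}) M R n :
  (n < M)%N -> (p * crank_tail M R)`_n = 0.
Proof.
move=> lt_nM; rewrite mulr_sumr coef_sum big1 // => r _.
rewrite -scalerAr coefZ coefMXn ifT ?mulr0 //.
by rewrite mulSn; lia.
Qed.

(** Each use of [crank_tailS] lowers [R] and raises [j], keeping [R + j] fixed; at [R = 0] the bound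
    gives [n < j], where both sides vanish. *)
Lemma crank_tail_npart N j R n : (n < N)%N -> (n < R + j)%N ->
  (\poly_(i < N) (npart i predT)%:Z * crank_tail j R)`_n =
  if (j <= n)%N then (npart (n - j) [pred l | ~~ has_arm j l])%:Z else 0.
Proof.
move=> lt_nN; elim: R j n lt_nN => [|R IHR] j n lt_nN lt_nRj.
  by rewrite /crank_tail big_ord0 mulr0 coef0 leqNgt lt_nRj.
rewrite crank_tailS mulrBr mulrCA coefB coefMXn coefXnM coef_poly.
case: ltnP => [// | le_jn]; rewrite ?subr0 //.
rewrite ifT ?IHR; try lia.
rewrite (npart_split (has_arm j) predT (n - j)) (npart_has_arm j).
rewrite PoszD; case: ltnP => _; rewrite ?add0n ?subr0 //.
by rewrite addrAC subrr add0r.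
Qed.

Lemma sum_crank_M j n M : (j <= M)%N -> (n < M)%N ->
  \sum_(j <= m < M) crank_M (Posz m) n =
  (\poly_(i < n.+1) (npart i predT)%:Z * crank_tail j n.+1)`_n.
Proof.
move=> le_jM lt_nM; set P := \poly_(i < _) _.
pose G m : {poly int} := \sum_(1 <= r < n.+2) garvan_term (Posz m) r.
have crankE m : crank_M (Posz m) n = (P * G m)`_n.
  rewrite coefM; apply: eq_bigr => i _.
  rewrite coef_poly ltn_ord fps_inv_qpoch; congr (_ * _).
  by rewrite (@garvan_sum_coef _ _ n.+1) // ltnS leq_subr.
under eq_bigr do rewrite crankE.
rewrite -coef_sum -mulr_sumr sum_garvan_term // mulrBr coefB.
by rewrite [X in _ - X]mul_crank_tail_coef0 ?subr0.
Qed.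

Theorem theorem8 (j n : nat) (le_jn : (j <= n)%N) :
  sums_from j (fun m : nat => crank_M (Posz m) n)
    (Posz #|[set l : intpart (n - j) | j \notin (frobenius_symbol l).1]|).
Proof.
(* Once [M] exceeds [n], the upper end T_M of the telescoped sum has no term of degree [n] or
   less. *)
exists n.+1 => M lt_nM; rewrite sum_crank_M ?(leq_trans le_jn (ltnW lt_nM)) //.
rewrite crank_tail_npart ?leq_addr // le_jn; congr Posz.
apply: eq_card => l; rewrite !inE mem_frobenius_top //.
by case/and3P: (valP l).
Qed.
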